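(* Let $G$ be an AH-algebra (the directed group of an e-ring $(R,E)$) and let $g\in G$. Then $s:=(g^{+})^{\mathrm o}-(g^{-})^{\mathrm o}$ is the unique signum of $g$; hence $G$ has the polar decomposition property (every element of $G$ has a signum in $G$). Moreover: (i) $s\in CC(g)$. (ii) $g^{\mathrm o}=s^{2}$. (iii) $|g|=sg=gs$. (iv) $g=s|g|=|g|s$. (v) $|g|^{\mathrm o}=g^{\mathrm o}$.
   Context: **e-rings.** An e-ring is a pair $(R,E)$ where $R$ is an associative ring with unity $1\neq 0$ and $E\subseteq R$ is a subset (elements called effects) such that $0,1\in E$; $e\in E\Rightarrow 1-e\in E$; and the set $E^{+}$ of all finite sums $e_1+\cdots+e_n$ with $e_i\in E$ satisfies, for all $a,b\in E^{+}$: (i) $-a\in E^{+}\Rightarrow a=0$; (ii) $1-a\in E^{+}\Rightarrow a\in E$; (iii) $ab=ba\Rightarrow ab\in E^{+}$; (iv) $aba\in E^{+}$; (v) $aba=0\Rightarrow ab=ba=0$; (vi) $(a-b)^2\in E^{+}$. The directed group of $(R,E)$ is $G:=E^{+}-E^{+}=\{a-b: a,b\in E^{+}\}$, a subgroup of the additive group of $R$, partially ordered by $g\leq h\Leftrightarrow h-g\in E^{+}$. The set of projections is $P:=\{p\in G: p=p^2\}$. Products of elements of $G$ are taken in $R$. **Commutants.** For $g,h\in G$, $gCh$ means $gh=hg$. For $A\subseteq G$, $C(A):=\{g\in G: gCa\ \forall a\in A\}$, $CC(A):=C(C(A))$; $C(g):=C(\{g\})$, $CC(g):=CC(\{g\})$;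 $CPC(g):=C(P\cap C(g))$. **AH-algebra.** $G$ is an AH-algebra iff: (1) there is an effect $\frac12\in E$ with $\frac12+\frac12=1$; (2) quadratic annihilation (QA): for all $g,h\in G$, $gh^2g=0\Rightarrow gh=hg=0$; (3) commutative Vigier (CV) property: every ascending sequence $g_1\leq g_2\leq\cdots$ of pairwise commuting elements of $G$ that is bounded above in $G$ has a supremum $g$ in $G$, and $g\in CC(\{g_n:n\in\mathbb N\})$. **Notation in an AH-algebra.** For $0\leq g\in G$, $g^{1/2}$ is the unique element of $G$ with $0\leq g^{1/2}$ and $(g^{1/2})^2=g$ (it exists). Since $0\le g^2$, one defines $|g|:=(g^2)^{1/2}$, $g^{+}:=\frac12(|g|+g)$, $g^{-}:=\frac12(|g|-g)$, all in $G$. The carrier projection $g^{\mathrm o}$ of $g\in G$ is the unique projection in $P$ such that for all $h\in G$, $gh=0\Leftrightarrow g^{\mathrm o}h=0$ (it exists). **Signum.** An element $s\in G$ is a signum of $g\in G$ iff: (i) $s\in C(g)\cap CPC(g)$; (ii) $0\leq sg=gs\in G$; (iii) $g=s^2g$; and (iv) for all $h\in G$, $gh=0\Rightarrow sh=0$. *)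

(* Defs.v *)
From mathcomp Require Import all_boot all_order all_algebra.
From mathcomp Require Import boolp classical_sets.

Set Implicit Arguments.
Unset Strict Implicit.
Unset Printing Implicit Defensive.

Import GRing.Theory.
Local Open Scope classical_set_scope.
Local Open Scope ring_scope.

(* The empty sum is allowed; it adds nothing, since 0 is an effect. *)
Definition Eplus (R : nzRingType) (E : set R) : set R :=
  [set a | exists (n : nat) (e : 'I_n -> R),
             (forall i, E (e i)) /\ a = \sum_(i < n) e i].

Record e_ring (R : nzRingType) (E : set R) : Prop := ERing {
  effect0 : E 0;
  effect1 : E 1;
  effectC : forall e, E e -> E (1 - e);
  Eplus_anti : forall a, Eplus E a -> Eplus E (- a) -> a = 0;
  Eplus_effect : forall a, Eplus E a -> Eplus E (1 - a) -> E a;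
  Eplus_mul : forall a b, Eplus E a -> Eplus E b ->
    a * b = b * a -> Eplus E (a * b);
  Eplus_quad : forall a b, Eplus E a -> Eplus E b -> Eplus E (a * b * a);
  Eplus_quad0 : forall a b, Eplus E a -> Eplus E b ->
    a * b * a = 0 -> a * b = 0 /\ b * a = 0;
  Eplus_sqrB : forall a b, Eplus E a -> Eplus E b -> Eplus E ((a - b) ^+ 2)
}.

Definition directed_group (R : nzRingType) (E : set R) : set R :=
  [set g | exists a b, [/\ Eplus E a, Eplus E b & g = a - b]].

Definition le_G (R : nzRingType) (E : set R) (g h : R) : Prop :=
  Eplus E (h - g).

Definition projections (R : nzRingType) (E : set R) : set R :=
  [set p | directed_group E p /\ p = p ^+ 2].

Definition commutant (R : nzRingType) (E : set R) (A : set R) : set R :=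
  [set g | directed_group E g /\ forall a, A a -> g * a = a * g].

Definition bicommutant (R : nzRingType) (E : set R) (A : set R) : set R :=
  commutant E (commutant E A).

Definition CPC (R : nzRingType) (E : set R) (g : R) : set R :=
  commutant E (projections E `&` commutant E [set g]).

Definition is_sup_G (R : nzRingType) (E : set R) (u : nat -> R) (x : R) : Prop :=
  [/\ directed_group E x,
      forall n, le_G E (u n) x
    & forall y, directed_group E y -> (forall n, le_G E (u n) y) -> le_G E x y].

Definition quadratic_annihilation (R : nzRingType) (E : set R) : Prop :=
  forall g h, directed_group E g -> directed_group E h ->
    g * h ^+ 2 * g = 0 -> g * h = 0 /\ h * g = 0.

Definition commutative_Vigier (R : nzRingType) (E : set R) : Prop :=
  forall u : nat -> R,
    (forall n, directed_group E (u n)) ->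
    (forall n, le_G E (u n) (u n.+1)) ->
    (forall m n, u m * u n = u n * u m) ->
    (exists2 b, directed_group E b & forall n, le_G E (u n) b) ->
    exists2 x, is_sup_G E u x & bicommutant E (range u) x.

Record AH_algebra (R : nzRingType) (E : set R) : Prop := AHAlgebra {
  AH_half : exists2 x, E x & x + x = 1;
  AH_QA : quadratic_annihilation E;
  AH_CV : commutative_Vigier E
}.

(* In an AH-algebra each set passed to [xget] below is a singleton (for the
   arguments at which the operation is meaningful), so the default value 0 is
   never taken. *)
Definition half_G (R : nzRingType) (E : set R) : R :=
  xget 0 [set x | E x /\ x + x = 1].

Definition sqrt_G (R : nzRingType) (E : set R) (g : R) : R :=
  xget 0 [set r | [/\ directed_group E r, le_G E 0 r & r ^+ 2 = g]].

Definition abs_G (R : nzRingType) (E : set R) (g : R) : R :=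
  sqrt_G E (g ^+ 2).

Definition pos_part (R : nzRingType) (E : set R) (g : R) : R :=
  half_G E * (abs_G E g + g).

Definition neg_part (R : nzRingType) (E : set R) (g : R) : R :=
  half_G E * (abs_G E g - g).

Definition carrier (R : nzRingType) (E : set R) (g : R) : R :=
  xget 0 [set p | projections E p /\
                  forall h, directed_group E h -> (g * h = 0 <-> p * h = 0)].

Record is_signum (R : nzRingType) (E : set R) (g s : R) : Prop := IsSignum {
  signum_in : directed_group E s;
  signum_comm : (commutant E [set g] `&` CPC E g) s;
  signum_pos : [/\ le_G E 0 (s * g), s * g = g * s & directed_group E (g * s)];
  signum_sqr : g = s ^+ 2 * g;
  signum_ann : forall h, directed_group E h -> g * h = 0 -> s * h = 0
}.

Definition polar_decomposition_property (R : nzRingType) (E : set R) : Prop :=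
  forall g, directed_group E g -> exists s, is_signum E g s.

(* Main.v *)
(* Order completeness along commuting sequences makes the order Archimedean and
   yields two constructions, each commuting with whatever commutes with the
   datum: the square root of [0 <= a <= 1], as [1 - x] with [x] the supremum of
   the iteration [x' = ((1 - a) + x ^ 2) / 2], and the carrier projection of [a],
   as the supremum of [1 - (1 - a) ^ n].  Halving reduces the general case to
   the unit interval.  Since [g+] and [g-] annihilate each other, so do their
   carriers [p] and [q], and then [(p - q) g = g+ + g- = |g|]. *)
From Stdlib Require Import Ncring Ncring_tac.
Require Import Defs.
From mathcomp Require Import all_boot all_order all_algebra.
From mathcomp Require Import boolp classical_sets.

Import GRing.Theory.
Local Open Scope classical_set_scope.
Local Open Scope ring_scope.

Section ERing.
Set Implicit Arguments.
Unset Strict Implicit.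

Context (R : nzRingType).

(** Makes [non_commutative_ring] available on [R], so that identities that hold in every ring are
    settled by normalisation. Steps that depend on a particular commutation stay explicit. *)
#[local] Instance nzRing_ncring_ops :
  @Ncring.Ring_ops R 0 1 (@GRing.add R) (@GRing.mul R) (fun x y => x - y) (@GRing.opp R)
    eq := {}.

#[local] Instance nzRing_ncring :
  @Ncring.Ring R 0 1 (@GRing.add R) (@GRing.mul R) (fun x y => x - y) (@GRing.opp R)
    eq nzRing_ncring_ops.
Proof.
split; try exact: _; try by move=> * ? ? ->.
- exact: (@add0r R).
- exact: (@addrC R).
- exact: (@addrA R).
- exact: (@mul1r R).
- exact: (@mulr1 R).
- exact: (@mulrA R).
- exact: (@mulrDl R).
- by move=> x y z; apply: (@mulrDr R).
- exact: (@subrr R).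
Qed.

Lemma sub_sqr_comm (x y : R) : x * y = y * x -> x * x - y * y = (x - y) * (x + y).
Proof.
move=> xy; have -> : (x - y) * (x + y) = x * x - y * y + (x * y - y * x).
  by non_commutative_ring.
by rewrite xy subrr addr0.
Qed.

(** * The positive cone and the directed group *)

Context (E : set R) (hE : e_ring E).
Local Notation P := (Eplus E).
Local Notation G := (directed_group E).

(** Treats the cone as generated from 0 by adding one effect at a time, which hides the indexed
    sums. *)
Lemma Eplus_ind (Q : R -> Prop) : Q 0 ->
  (forall a e, P a -> E e -> Q a -> Q (a + e)) -> forall a, P a -> Q a.
Proof.
move=> Q0 QS a [n [e [Ee ->]]]; elim: n e Ee => [|n IHn] e Ee.
  by rewrite big_ord0.
rewrite big_ord_recr /=; apply: QS => //; last exact: IHn.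
by exists n, (fun i => e (widen_ord (leqnSn n) i)).
Qed.

Lemma Eplus_snoc a e : P a -> E e -> P (a + e).
Proof.
move=> [n [f [Ef ->]]] Ee.
exists n.+1, (fun i => if unlift ord_max i is Some j then f j else e); split.
  by move=> i; case: (unlift _ _).
rewrite big_ord_recr /= unlift_none; congr (_ + _); apply: eq_bigr => i _.
suff -> : widen_ord (leqnSn n) i = lift ord_max i by rewrite liftK.
by apply: val_inj; rewrite /= /bump leqNgt ltn_ord.
Qed.

Lemma Eplus0 : P 0.
Proof. by exists 0%N, (fun _ => 0); split; [case|rewrite big_ord0]. Qed.

Lemma Eplus_E e : E e -> P e.
Proof. by move=> Ee; rewrite -[e]add0r; apply: Eplus_snoc => //; exact: Eplus0. Qed.

Lemma Eplus1 : P 1.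
Proof. exact/Eplus_E/(effect1 hE). Qed.

Lemma EplusD a b : P a -> P b -> P (a + b).
Proof.
move=> Pa; move: b; apply: Eplus_ind; first by rewrite addr0.
by move=> b e _ Ee Pab; rewrite addrA; exact: Eplus_snoc.
Qed.

Lemma EplusM a b : P a -> P b -> a * b = b * a -> P (a * b).
Proof. exact: Eplus_mul. Qed.

Lemma Eplus_trans a b c : P (b - a) -> P (c - b) -> P (c - a).
Proof.
move=> Pab Pbc; have -> : c - a = (c - b) + (b - a) by non_commutative_ring.
exact: EplusD.
Qed.

Lemma Eplus_le_anti a b : P (a - b) -> P (b - a) -> a = b.
Proof.
move=> Pab Pba; apply: subr0_eq; apply: (Eplus_anti hE) => //.
by rewrite opprB.
Qed.

Lemma Eplus_add0 a b : P a -> P b -> a + b = 0 -> a = 0.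
Proof.
move=> Pa Pb ab0; apply: (Eplus_anti hE) => //.
suff -> : - a = b by [].
by apply/eqP; rewrite eq_sym -addr_eq0 addrC ab0.
Qed.

Lemma directed_Eplus a : P a -> G a.
Proof. by move=> Pa; exists a, 0; split => //; [exact: Eplus0|rewrite subr0]. Qed.

Lemma directedD a b : G a -> G b -> G (a + b).
Proof.
move=> [a1 [a2 [P1 P2 ->]]] [b1 [b2 [Q1 Q2 ->]]].
exists (a1 + b1), (a2 + b2); split; [exact: EplusD|exact: EplusD|].
by non_commutative_ring.
Qed.

Lemma directedN a : G a -> G (- a).
Proof. by move=> [a1 [a2 [P1 P2 ->]]]; exists a2, a1; split => //; rewrite opprB. Qed.

Lemma directedB a b : G a -> G b -> G (a - b).
Proof. by move=> Ga Gb; apply/directedD/directedN. Qed.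

Lemma directed1 : G 1.
Proof. exact/directed_Eplus/Eplus1. Qed.

Lemma Eplus_sqr g : G g -> P (g * g).
Proof. by move=> [a [b [Pa Pb ->]]]; have := Eplus_sqrB hE Pa Pb; rewrite expr2. Qed.

(** * Halving, quadratic annihilation and scaling *)

Context (hAH : AH_algebra E).
Local Notation h := (half_G E).

Lemma half_GP : E h /\ h + h = 1.
Proof.
have [x Ex xx] := AH_half hAH.
by have := @xgetPex R 0 [set x | E x /\ x + x = 1] (ex_intro _ x (conj Ex xx)).
Qed.

Lemma half_half : h + h = 1.
Proof. by case: half_GP. Qed.

Lemma Eplus_half : P h.
Proof. by case: half_GP => /Eplus_E. Qed.

(** Both sides equal [h * x * h + h * x * h], because [h + h = 1] can be inserted on either side. *)
Lemma half_central x : h * x = x * h.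
Proof.
have -> : h * x = h * x * (h + h) by rewrite half_half mulr1.
have -> : h * x * (h + h) = (h + h) * x * h by non_commutative_ring.
by rewrite half_half mul1r.
Qed.

Lemma Eplus_halfM a : P a -> P (h * a).
Proof. by move=> Pa; apply: EplusM => //; [exact: Eplus_half|exact: half_central]. Qed.

Lemma directed_halfM a : G a -> G (h * a).
Proof.
move=> [b [c [Pb Pc ->]]]; rewrite mulrBr.
by apply: directedB; exact/directed_Eplus/Eplus_halfM.
Qed.

Lemma quadratic_ann a b : G a -> G b -> a * (b * b) * a = 0 -> a * b = 0.
Proof. by move=> Ga Gb ab; case: (AH_QA hAH Ga Gb); rewrite ?expr2. Qed.

(** The product [b * a ^ 2 * b] contains the factor [a * b], so quadratic annihilation applies with
    the roles exchanged. *)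
Lemma annihilateC a b : G a -> G b -> a * b = 0 -> b * a = 0.
Proof.
move=> Ga Gb ab; apply: quadratic_ann => //.
by rewrite -mulrA -[a * a * b]mulrA ab !mulr0.
Qed.

Lemma sqr_eq0_directed a : G a -> a * a = 0 -> a = 0.
Proof.
move=> Ga aa; rewrite -[a]mulr1; apply: quadratic_ann directed1 _ => //.
by rewrite !mulr1.
Qed.

(** Here [d] is a power of two and [c] its inverse. The scale enters as the square [c * c], so that
    a root of [c * c * a] only has to be multiplied by [d] to give a root of [a]. *)
Lemma exists_scaling a : P a -> exists c d,
  [/\ P c, P d, d * c = 1, (forall x, c * x = x * c) /\ (forall x, d * x = x * d)
    & P (1 - c * c * a)].
Proof.
move=> Pa0; have [c [d [[Pc Pd dc] cC dC] [Pd1 Pda]]] : exists c d,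
    [/\ [/\ P c, P d & d * c = 1], forall x, c * x = x * c, forall x, d * x = x * d
      & P (d - 1) /\ P (d - a)].
  move: a Pa0; apply: Eplus_ind.
    exists 1, 1; split; try by move=> x; rewrite mulr1 mul1r.
      by split; [exact: Eplus1|exact: Eplus1|rewrite mulr1].
    by rewrite subrr subr0; split; [exact: Eplus0|exact: Eplus1].
  move=> a e Pa Ee [c [d [[Pc Pd dc] cC dC] [Pd1 Pda]]].
  (* One doubling absorbs one more effect: one copy of [d] dominates [a], the other dominates 1 and
     hence [e]. *)
  exists (h * c), (d + d); split.
  - split; [exact: Eplus_halfM|exact: EplusD|].
    have -> : (d + d) * (h * c) = d * (h + h) * c by non_commutative_ring.
    by rewrite half_half mulr1.
  - by move=> x; rewrite -mulrA cC mulrA half_central mulrA.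
  - by move=> x; rewrite mulrDl mulrDr dC.
  - have Pe := Eplus_E (effectC hE Ee).
    split.
      have -> : d + d - 1 = (d - 1) + d by non_commutative_ring.
      exact: EplusD.
    have -> : d + d - (a + e) = (d - a) + (d - 1) + (1 - e) by non_commutative_ring.
    by apply: EplusD => //; exact: EplusD.
exists c, d; split=> //.
have cd : c * d = 1 by rewrite cC.
have -> : 1 - c * c * a = c * (d - 1) + c * (c * (d - a)).
  have -> : c * (d - 1) + c * (c * (d - a)) = c * d - c + c * (c * d) - c * c * a.
    by non_commutative_ring.
  by rewrite cd mulr1 subrK.
have Pcda : P (c * (d - a)) by exact: EplusM.
by apply: EplusD; exact: EplusM.
Qed.

(** * Suprema of commuting sequences and the Archimedean property *)

Lemma sup_Eplus (u : nat -> R) : (forall n, P (u n)) -> (forall n, P (u n.+1 - u n)) ->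
    (forall m n, u m * u n = u n * u m) ->
    (exists2 b, G b & forall n, P (b - u n)) ->
  exists x, [/\ P x, forall n, P (x - u n),
    forall y, G y -> (forall n, P (y - u n)) -> P (y - x)
    & forall y, G y -> (forall n, y * u n = u n * y) -> y * x = x * y].
Proof.
move=> Pu Pinc uC hb.
have [x [Gx ux xmin] [_ xCC]] := AH_CV hAH (fun n => directed_Eplus (Pu n)) Pinc uC hb.
exists x; split => //.
  by rewrite -[x](subrK (u 0%N)); apply: EplusD => //; exact: ux.
move=> y Gy yu; rewrite xCC //; split => // _ [n _ <-]; exact: yu.
Qed.

(** Let [x] be the supremum of the multiples of [a]. Since [a *+ n.+1] is below [x] for every [n],
    [x - a] is an upper bound too, so [- a] is positive. *)
Lemma archimedean_Eplus a b : P a -> G b -> (forall n, P (b - a *+ n)) -> a = 0.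
Proof.
move=> Pa Gb Pab.
have Pan n : P (a *+ n).
  by elim: n => [|n IHn]; [exact: Eplus0|rewrite mulrS; exact: EplusD].
have [||||x [Px ux xmin _]] := @sup_Eplus (fun n => a *+ n) => //.
- by move=> n; rewrite mulrS addrK.
- by move=> m n; rewrite mulrnAl mulrnAr mulrnAl mulrnAr -!mulrnA mulnC.
- by exists b.
apply: (Eplus_anti hE) => //.
have -> : - a = (x - a) - x by non_commutative_ring.
apply: xmin; first by apply: directedB; exact: directed_Eplus.
move=> n; have -> : x - a - a *+ n = x - a *+ n.+1.
  by rewrite mulrS; non_commutative_ring.
exact: ux.
Qed.

(** * Square roots by monotone iteration *)

(* With [r = 1 - x], the equation [r ^ 2 = a] reads [x = ((1 - a) + x ^ 2) / 2]. *)
Fixpoint sqrt_approx (b : R) (n : nat) : R :=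
  if n is n'.+1 then h * (b + sqrt_approx b n' * sqrt_approx b n') else 0.

Lemma sqrt_approx_comm b y n :
  y * b = b * y -> y * sqrt_approx b n = sqrt_approx b n * y.
Proof.
move=> yb; elim: n => [|n IHn] /=; first by rewrite mulr0 mul0r.
apply: commrM; first exact/esym/half_central.
by apply: commrD => //; exact: commrM.
Qed.

Lemma sqrt_approx_commute b m n :
  sqrt_approx b m * sqrt_approx b n = sqrt_approx b n * sqrt_approx b m.
Proof. by apply: sqrt_approx_comm; symmetry; exact: sqrt_approx_comm. Qed.

Lemma sqrt_approxS b n :
  sqrt_approx b n.+1 + sqrt_approx b n.+1 = b + sqrt_approx b n * sqrt_approx b n.
Proof. by rewrite /= -mulrDl half_half mul1r. Qed.

(** The iterates ascend within the unit interval and commute, so they have a supremum [z]. That [z]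
    solves the fixed-point equation is derived from the order alone, by an Archimedean estimate of
    the defect instead of a continuity argument. *)
Lemma exists_sqrt_interval a : P a -> P (1 - a) -> exists r,
  [/\ P r, r * r = a & forall y, G y -> y * a = a * y -> y * r = r * y].
Proof.
move=> Pa Pb; set b := 1 - a in Pb; pose x := sqrt_approx b.
have xC m n : x m * x n = x n * x m by exact: sqrt_approx_commute.
have Px n : P (x n).
  elim: n => [|n IHn]; first exact: Eplus0.
  by apply: Eplus_halfM; apply: EplusD => //; exact: EplusM.
have Pinc n : P (x n.+1 - x n).
  elim: n => [|n IHn]; first by rewrite subr0.
  have -> : x n.+2 - x n.+1 = h * ((x n.+1 - x n) * (x n.+1 + x n)).
    by rewrite -sub_sqr_comm // /x /=; non_commutative_ring.
  apply/Eplus_halfM/EplusM => //; first exact: EplusD.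
  by symmetry; apply: commrB; symmetry; apply: commrD.
have Px1 n : P (1 - x n).
  elim: n => [|n IHn]; first by rewrite subr0; exact: Eplus1.
  have -> : 1 - x n.+1 = h * (a + (1 - x n) * (1 + x n)).
    have -> : 1 - x n.+1 = (h + h) - x n.+1 by rewrite half_half.
    by rewrite /x /= /b; non_commutative_ring.
  apply: Eplus_halfM; apply: EplusD => //; apply: EplusM => //.
    by apply: EplusD => //; exact: Eplus1.
  by non_commutative_ring.
have [|z [Pz xz zmin zC]] := sup_Eplus Px Pinc xC.
  by exists 1 => //; exact: directed1.
have zx n : z * x n = x n * z.
  by symmetry; apply: zC; [exact: directed_Eplus|move=> m; exact: xC].
have Pz1 : P (1 - z) by apply: zmin => //; exact: directed1.
have Pdiff n y : y * z = z * y -> y * x n = x n * y -> P y -> P ((z - x n) * y).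
  by move=> yz yx Py; apply: EplusM => //; symmetry; exact: commrB.
(* Twice the defect of [z] in the equation [z = h * (b + z * z)]. It is positive because
   [h * (b + z * z)] bounds all iterates, hence also [z]. *)
pose d := b + z * z - (z + z).
have Pd : P d.
  have -> : d = (h * (b + z * z) - z) + (h * (b + z * z) - z).
    have -> : d = 1 * (b + z * z) - (z + z) by rewrite mul1r.
    by rewrite -half_half; non_commutative_ring.
  have Pw : P (h * (b + z * z)).
    by apply: Eplus_halfM; apply: EplusD => //; exact: EplusM.
  suff Q : P (h * (b + z * z) - z) by exact: EplusD.
  apply: zmin; first exact: directed_Eplus.
  case=> [|n]; first by rewrite subr0.
  have -> : h * (b + z * z) - x n.+1 = h * ((z - x n) * (z + x n)).
    by rewrite -sub_sqr_comm // /x /=; non_commutative_ring.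
  apply/Eplus_halfM/Pdiff; last exact: EplusD.
    by symmetry; apply: commrD.
  by symmetry; apply: commrD.
(* By the recursion the difference factors as [z - x n] times [(1 - z) + (1 - x n)], both
   positive. *)
have d_le n : P ((x n.+1 - x n) + (x n.+1 - x n) - d).
  have -> : (x n.+1 - x n) + (x n.+1 - x n) - d = (z - x n) * ((1 - z) + (1 - x n)).
    have -> : (x n.+1 - x n) + (x n.+1 - x n) - d
        = (x n.+1 + x n.+1) - (x n + x n) - d by non_commutative_ring.
    rewrite /x sqrt_approxS -/(x n) /d.
    have -> : (z - x n) * ((1 - z) + (1 - x n)) =
        z + z - (x n + x n) - (z * z - x n * x n) + (x n * z - z * x n).
      by non_commutative_ring.
    by rewrite zx subrr addr0; non_commutative_ring.
  apply: Pdiff; last exact: EplusD.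
    symmetry; apply: commrD; apply: commrB => //; exact: commr1.
  symmetry; apply: commrD; apply: commrB => //; exact: commr1.
(* Telescoping from [x 0 = 0]: the multiples of [d] stay below [x n + x n], hence below 2. *)
have sum_d n : P (x n + x n - d *+ n).
  elim: n => [|n IHn]; first by rewrite !subr0 addr0; exact: Eplus0.
  have -> : x n.+1 + x n.+1 - d *+ n.+1
      = (x n + x n - d *+ n) + ((x n.+1 - x n) + (x n.+1 - x n) - d).
    by rewrite mulrS; non_commutative_ring.
  exact: EplusD.
have d0 : d = 0.
  apply: (@archimedean_Eplus _ (1 + 1)) => //.
    by apply: directedD; exact: directed1.
  move=> n; apply: (Eplus_trans (sum_d n)).
  have -> : 1 + 1 - (x n + x n) = (1 - x n) + (1 - x n) by non_commutative_ring.
  exact: EplusD.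
exists (1 - z); split => //.
  have -> : (1 - z) * (1 - z) = a + d by rewrite /d /b; non_commutative_ring.
  by rewrite d0 addr0.
move=> y Gy ya; apply: commrB; first exact: commr1.
apply: zC => // n; apply: sqrt_approx_comm; apply: commrB => //; exact: commr1.
Qed.

Lemma exists_sqrt a : P a -> exists r,
  [/\ P r, r * r = a & forall y, G y -> y * a = a * y -> y * r = r * y].
Proof.
move=> Pa; have [c [d [Pc Pd dc [cC dC] Pca]]] := exists_scaling Pa.
have Pcc : P (c * c) by exact: EplusM.
have [|r [Pr rr rC]] := @exists_sqrt_interval (c * c * a) _ Pca.
  by apply: EplusM => //; rewrite -mulrA cC -mulrA cC !mulrA.
exists (d * r); split; first exact: EplusM.
  rewrite mulrA -[d * r * d]mulrA -dC [d * (d * r)]mulrA -mulrA rr.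
  by rewrite !mulrA -[d * d * c]mulrA dc mulr1 dc mul1r.
move=> y Gy ya; apply: commrM; first exact/esym/dC.
by apply: rC => //; apply: commrM => //; apply: commrM; apply/esym/cC.
Qed.

(** * Uniqueness of positive square roots and the absolute value *)

(** With [z = r - t], commutation gives [z * (r + t) = 0]. Then [z ^ 2 * r] and [z ^ 2 * t] are
    positive with sum 0, so both vanish and [z ^ 3 = 0]; quadratic annihilation removes the
    powers. *)
Lemma sqrt_unique_comm r t : P r -> P t -> r * t = t * r -> r * r = t * t -> r = t.
Proof.
move=> Pr Pt rt rrtt; apply: subr0_eq; set z := r - t.
have Gz : G z by apply: directedB; exact: directed_Eplus.
have zr : z * r = r * z by symmetry; apply: commrB.
have zt : z * t = t * z by symmetry; apply: commrB.
have zrt : z * (r + t) = 0 by rewrite /z -sub_sqr_comm // rrtt subrr.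
have Pzz := Eplus_sqr Gz.
have Pzzr : P (z * z * r) by apply: EplusM => //; symmetry; apply: commrM.
have Pzzt : P (z * z * t) by apply: EplusM => //; symmetry; apply: commrM.
have sum0 : z * z * r + z * z * t = 0 by rewrite -mulrDr -mulrA zrt mulr0.
have zzr := Eplus_add0 Pzzr Pzzt sum0.
have zzt : z * z * t = 0 by move: sum0; rewrite zzr add0r.
have zzz : z * z * z = 0 by rewrite {3}/z mulrBr zzr zzt subrr.
apply: sqr_eq0_directed => //; apply: quadratic_ann => //.
by rewrite mulrA zzz mul0r.
Qed.

(** Two roots are not known to commute with each other, but each commutes with the common square,
    hence with the constructed root [w]; both therefore equal [w]. *)
Lemma sqrt_unique r t : P r -> P t -> r * r = t * t -> r = t.
Proof.
move=> Pr Pt rrtt; have [w [Pw ww wC]] := exists_sqrt (Eplus_sqr (directed_Eplus Pt)).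
have tw : t = w.
  by apply: sqrt_unique_comm => //; apply: wC; [exact: directed_Eplus|rewrite mulrA].
have rw : r = w.
  apply: sqrt_unique_comm => //; last by rewrite ww.
  by apply: wC; [exact: directed_Eplus|rewrite -rrtt mulrA].
by rewrite tw.
Qed.

Lemma abs_G_unique g r : P r -> r * r = g * g -> abs_G E g = r.
Proof.
move=> Pr rr; apply: xget_unique.
  by split; [exact: directed_Eplus|rewrite /le_G subr0|rewrite !expr2].
move=> t [_]; rewrite /le_G subr0 !expr2 => Pt tt.
by apply: sqrt_unique => //; rewrite rr.
Qed.

Lemma abs_GP g : G g -> [/\ P (abs_G E g), abs_G E g * abs_G E g = g * g
  & forall y, G y -> y * g = g * y -> y * abs_G E g = abs_G E g * y].
Proof.
move=> Gg; have [r [Pr rr rC]] := exists_sqrt (Eplus_sqr Gg).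
rewrite (abs_G_unique Pr rr); split => // y Gy yg.
by apply: rC => //; exact: commrM.
Qed.

(** * Carrier projections *)

(** The complement [q = 1 - p] is the infimum of the powers of [1 - a]. It turns out to be the
    largest element of the unit interval annihilated by [a], and this maximality yields both
    idempotence and the annihilator condition. *)
Lemma exists_carrier_interval a : P a -> P (1 - a) -> exists p,
  [/\ P p, p * p = p, forall x, G x -> (a * x = 0 <-> p * x = 0)
    & forall y, G y -> y * a = a * y -> y * p = p * y].
Proof.
move=> Pa Pc; have Ga := directed_Eplus Pa; pose C n : R := (1 - a) ^+ n.
have CS n : C n.+1 = C n - a * C n by rewrite /C exprS mulrBl mul1r.
have commC y n : y * a = a * y -> y * C n = C n * y.
  by move=> ya; apply: commrX; apply: commrB => //; exact: commr1.
have aC n : a * C n = C n * a by exact: commC.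
have CC m n : C m * C n = C n * C m by apply: commC; symmetry.
have PC n : P (C n).
  elim: n => [|n IHn]; first exact: Eplus1.
  rewrite /C exprS; apply: EplusM => //.
  by symmetry; apply: commrB; [exact: commr1|symmetry; exact: aC].
have PaC n : P (a * C n) by exact: EplusM.
pose u n : R := 1 - C n.
have uS n : u n.+1 - u n = a * C n by rewrite /u CS; non_commutative_ring.
have Pu n : P (u n).
  elim: n => [|n IHn]; first by rewrite /u subrr; exact: Eplus0.
  by rewrite -[u n.+1](subrK (u n)) uS; exact: EplusD.
have uC m n : u m * u n = u n * u m.
  apply: commrB; first exact: commr1.
  by symmetry; apply: commrB; [exact: commr1|].
have [||p [Pp up pmin pC]] := sup_Eplus Pu _ uC.
- by move=> n; rewrite uS.
- exists 1; first exact: directed1.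
  by move=> n; rewrite /u opprB addrC subrK.
have commp y : G y -> y * a = a * y -> y * p = p * y.
  move=> Gy ya; apply: pC => // n; apply: commrB; first exact: commr1.
  exact: commC.
have ap : a * p = p * a by exact: commp.
have Gp := directed_Eplus Pp.
pose q : R := 1 - p.
have Pq : P q.
  by apply: pmin; [exact: directed1|move=> n; rewrite /u opprB addrC subrK].
have Gq := directed_Eplus Pq.
have aq : a * q = q * a by apply: commrB => //; exact: commr1.
have Cq n : P (C n - q).
  by have -> : C n - q = p - u n by rewrite /q /u; non_commutative_ring.
(* Each increment [a * C n] of [u] dominates [a * q], so the multiples of [a * q] stay below [u n],
   hence below 1. *)
have aq0 : a * q = 0.
  apply: (@archimedean_Eplus _ 1) => //; [exact: EplusM|exact: directed1|move=> n].
  apply: (@Eplus_trans _ (u n)); last by rewrite /u opprB addrC subrK.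
  elim: n => [|n IHn]; first by rewrite /u !subrr; exact: Eplus0.
  have -> : u n.+1 - (a * q) *+ n.+1 = (u n - (a * q) *+ n) + a * (C n - q).
    rewrite mulrS -[u n.+1](subrK (u n)) uS; non_commutative_ring.
  by apply: EplusD => //; apply: EplusM => //; apply: commrB.
(* If [a * y = 0] then [C n * y = y], so [1 - y - u n = C n * (1 - y)] is positive and [1 - y] is an
   upper bound of [u]. *)
have qmax y : P y -> P (1 - y) -> a * y = 0 -> P (q - y).
  move=> Py Py1 ay; have Gy := directed_Eplus Py.
  have ya := annihilateC Ga Gy ay.
  have -> : q - y = (1 - y) - p by rewrite /q; non_commutative_ring.
  apply: pmin; first exact: directed_Eplus.
  move=> n; have -> : 1 - y - u n = C n * (1 - y).
    have Cy : C n * y = y.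
      elim: n => [|n IHn]; first by rewrite /C mul1r.
      by rewrite CS mulrBl IHn -mulrA IHn ay subr0.
    by rewrite mulrBr mulr1 Cy /u; non_commutative_ring.
  apply: EplusM => //; apply: commrB; first exact: commr1.
  by symmetry; apply: commC; rewrite ay ya.
have qq : q * q = q.
  have Pqq : P (q * (1 - q)).
    apply: EplusM; [by []|by rewrite /q opprB addrC subrK|].
    by non_commutative_ring.
  apply: Eplus_le_anti; last first.
    by have -> : q - q * q = q * (1 - q) by non_commutative_ring.
  (* The element [q * (1 - q) + q = 1 - (1 - q) ^ 2] lies in the unit interval and is annihilated by
     [a]; maximality puts it below [q]. *)
  have -> : q * q - q = q - (q * (1 - q) + q) by non_commutative_ring.
  apply: qmax; first exact: EplusD.
    have -> : 1 - (q * (1 - q) + q) = (1 - q) * (1 - q) by non_commutative_ring.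
    by apply: Eplus_sqr; apply: directedB => //; exact: directed1.
  by rewrite mulrDr mulrA aq0 mul0r addr0.
have pE : p = 1 - q by rewrite /q; non_commutative_ring.
have pq : p * q = 0 by rewrite pE mulrBl mul1r qq subrr.
exists p; split => //.
  have -> : p * p = p - p * q by rewrite /q; non_commutative_ring.
  by rewrite pq subr0.
move=> x Gx; split => [ax|px]; last first.
  have -> : x = q * x by rewrite /q mulrBl mul1r px subr0.
  by rewrite mulrA aq0 mul0r.
(* Maximality of [q] concerns the unit interval, so [x * x] is first scaled to [t] there. From [t]
   below [q], [p * t * p] lies between 0 and [p * q * p = 0]; so [p * t = 0], and then [p * x = 0]
   by quadratic annihilation. *)
have Pxx := Eplus_sqr Gx.
have [c [d [Pc' Pd dc [cC dC] Pcx]]] := exists_scaling Pxx.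
set t := c * c * (x * x) in Pcx.
have Pt : P t.
  apply: EplusM => //; first exact: EplusM.
  by rewrite -mulrA cC -mulrA cC mulrA.
have at0 : a * t = 0.
  by rewrite /t -mulrA cC -mulrA -mulrA cC !mulrA ax !mul0r.
have Pqt := qmax _ Pt Pcx at0.
have ptp : p * t * p = 0.
  apply: (Eplus_anti hE); first exact: (Eplus_quad hE).
  have -> : - (p * t * p) = p * (q - t) * p.
    by rewrite mulrBr pq sub0r mulNr.
  exact: (Eplus_quad hE).
have [pt _] := Eplus_quad0 hE Pp Pt ptp.
have xxE : x * x = d * d * t.
  by rewrite /t !mulrA -[d * d * c]mulrA dc mulr1 dc mul1r.
apply: quadratic_ann => //.
have -> : p * (x * x) = d * d * (p * t).
  by rewrite xxE !mulrA -[p * d]dC -[d * p * d]mulrA -[p * d]dC !mulrA.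
by rewrite pt mulr0 mul0r.
Qed.

Definition is_carrier (g p : R) : Prop :=
  projections E p /\ forall x, G x -> (g * x = 0 <-> p * x = 0).

(** By quadratic annihilation [g] and [g * g] have the same annihilator, so the carrier of the
    scaled positive element [c * c * (g * g)] serves for [g]. *)
Lemma exists_carrier g : G g -> exists p,
  is_carrier g p /\ forall y, G y -> y * g = g * y -> y * p = p * y.
Proof.
move=> Gg; have Pgg := Eplus_sqr Gg.
have [c [d [Pc Pd dc [cC dC] Pcg]]] := exists_scaling Pgg.
have ccC x : c * c * x = x * (c * c) by rewrite -mulrA cC -mulrA cC !mulrA.
have [|p [Pp pp pann pC]] := @exists_carrier_interval (c * c * (g * g)) _ Pcg.
  by apply: EplusM => //; exact: EplusM.
exists p; split; last first.
  by move=> y Gy yg; apply: pC => //; apply: commrM => //; exact: commrM.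
split; first by split; [exact: directed_Eplus|rewrite expr2 pp].
move=> x Gx; apply: iff_trans (pann x Gx); split => [gx|ccggx].
  by rewrite -!mulrA gx !mulr0.
have ggx : g * g * x = 0.
  have -> : g * g * x = d * (d * (c * c * (g * g) * x)).
    by rewrite !mulrA -[d * d * c]mulrA dc mulr1 dc mul1r.
  by rewrite ccggx !mulr0.
apply: annihilateC => //; apply: quadratic_ann => //.
by rewrite -mulrA ggx mulr0.
Qed.

(** Two projections with the same annihilator each annihilate the complement of the other, so
    [p = q * p = q]. *)
Lemma carrier_unique g p : is_carrier g p -> carrier E g = p.
Proof.
move=> gp; apply: xget_unique => // q [[Gq qq] qann].
have {gp} [[Gp pp] pann] := gp.
have ann r t : G r -> G t -> r = r ^+ 2 ->
    (forall x, G x -> (g * x = 0 <-> r * x = 0)) ->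
    (forall x, G x -> (g * x = 0 <-> t * x = 0)) -> t * (1 - r) = 0.
  move=> Gr Gt rr rann tann.
  have G1r : G (1 - r) by apply: directedB => //; exact: directed1.
  by apply/(tann _ G1r)/(rann _ G1r); rewrite mulrBr mulr1 -expr2 -rr subrr.
have qp : q * (1 - p) = 0 by exact: ann.
have pq : (1 - q) * p = 0.
  apply: annihilateC => //; last exact: ann.
  by apply: directedB => //; exact: directed1.
have -> : p = q * p by apply: subr0_eq; rewrite -[X in X - _]mul1r -mulrBl.
by apply: subr0_eq; rewrite -[X in X - _]mulr1 -mulrBr.
Qed.

Lemma carrierP g : G g -> is_carrier g (carrier E g) /\
  forall y, G y -> y * g = g * y -> y * carrier E g = carrier E g * y.
Proof.
by move=> Gg; have [p [gp pC]] := exists_carrier Gg; rewrite (carrier_unique gp).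
Qed.

Lemma carrier_mul g : G g -> carrier E g * g = g /\ g * carrier E g = g.
Proof.
move=> Gg; have [[[Gp pp] ann] _] := carrierP Gg; set p := carrier E g in Gp pp ann *.
have G1p : G (1 - p) by apply: directedB => //; exact: directed1.
have gp : g * (1 - p) = 0.
  by apply/(ann _ G1p); rewrite mulrBr mulr1 -expr2 -pp subrr.
split; apply/esym/subr0_eq; last by rewrite -[X in X - _]mulr1 -mulrBr.
by rewrite -[X in X - _]mul1r -mulrBl; exact: annihilateC.
Qed.

(** * Positive and negative parts, their carriers and the signum *)

Section Signum.
Variables (g : R) (hg : G g).
Local Notation a := (abs_G E g).
Local Notation gp := (pos_part E g).
Local Notation gn := (neg_part E g).
Local Notation p := (carrier E gp).
Local Notation q := (carrier E gn).
Local Notation s := (p - q).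

Let Pa : P a. Proof. by case: (abs_GP hg). Qed.
Let aa : a * a = g * g. Proof. by case: (abs_GP hg). Qed.
Let ag : a * g = g * a.
Proof. by case: (abs_GP hg) => _ _ aC; rewrite -aC. Qed.

Let Ga : G a := directed_Eplus Pa.

Lemma directed_pos_part : G gp.
Proof. exact/directed_halfM/directedD. Qed.

Lemma directed_neg_part : G gn.
Proof. exact/directed_halfM/directedB. Qed.

Lemma pos_partD_neg_part : gp + gn = a.
Proof.
rewrite /pos_part /neg_part -mulrDr.
have -> : a + g + (a - g) = a + a by non_commutative_ring.
by rewrite mulrDr -mulrDl half_half mul1r.
Qed.

Lemma pos_partB_neg_part : gp - gn = g.
Proof.
rewrite /pos_part /neg_part -mulrBr.
have -> : a + g - (a - g) = g + g by non_commutative_ring.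
by rewrite mulrDr -mulrDl half_half mul1r.
Qed.

Lemma pos_part_mul_neg_part : gp * gn = 0.
Proof.
rewrite /pos_part /neg_part -mulrA [(a + g) * _]mulrA -half_central -mulrA.
have -> : (a + g) * (a - g) = a * a - g * g - (a * g - g * a) by non_commutative_ring.
by rewrite aa ag !subrr !mulr0.
Qed.

Lemma comm_abs_parts y : G y -> y * g = g * y -> y * gp = gp * y /\ y * gn = gn * y.
Proof.
move=> Gy yg; have [_ _ aC] := abs_GP hg; have ya := aC y Gy yg.
have yh : y * h = h * y by rewrite half_central.
by split; apply: commrM => //; [exact: commrD|exact: commrB].
Qed.

Lemma comm_carrier_parts y : G y -> y * g = g * y -> y * p = p * y /\ y * q = q * y.
Proof.
move=> Gy yg; have [yp yn] := comm_abs_parts Gy yg.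
have [_ pC] := carrierP directed_pos_part.
have [_ qC] := carrierP directed_neg_part.
by split; [exact: pC|exact: qC].
Qed.

Let Gp : G p. Proof. by have [[[]]] := carrierP directed_pos_part. Qed.
Let Gq : G q. Proof. by have [[[]]] := carrierP directed_neg_part. Qed.
Let pp : p * p = p.
Proof. by have [[[_ e] _] _] := carrierP directed_pos_part; rewrite -expr2 -e. Qed.
Let qq : q * q = q.
Proof. by have [[[_ e] _] _] := carrierP directed_neg_part; rewrite -expr2 -e. Qed.

Lemma directed_signum : G s.
Proof. exact: directedB. Qed.

Lemma signum_bicommutes y : G y -> y * g = g * y -> y * s = s * y.
Proof. by move=> Gy yg; have [yp yq] := comm_carrier_parts Gy yg; exact: commrB. Qed.

(** Starting from [gp * gn = 0], the left factor is replaced by its carrier, the factors are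
    swapped, and [gn] is replaced by its carrier in turn. *)
Lemma carrier_parts_orthogonal : p * q = 0 /\ q * p = 0.
Proof.
have [[_ pann] _] := carrierP directed_pos_part.
have [[_ qann] _] := carrierP directed_neg_part.
have qp : q * p = 0.
  apply/(qann _ Gp); apply: annihilateC => //; first exact: directed_neg_part.
  by apply/(pann _ directed_neg_part)/pos_part_mul_neg_part.
by split => //; exact: annihilateC.
Qed.

Lemma carrier_parts_annihilate : p * gn = 0 /\ q * gp = 0.
Proof.
have [[_ pann] _] := carrierP directed_pos_part.
have [[_ qann] _] := carrierP directed_neg_part.
split; first by apply/(pann _ directed_neg_part)/pos_part_mul_neg_part.
apply/(qann _ directed_pos_part)/annihilateC/pos_part_mul_neg_part.
  exact: directed_pos_part.
exact: directed_neg_part.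
Qed.

Lemma signum_mul : s * g = a.
Proof.
have [pn qp] := carrier_parts_annihilate.
rewrite -[X in s * X]pos_partB_neg_part -[RHS]pos_partD_neg_part.
have [pgp _] := carrier_mul directed_pos_part.
have [qgn _] := carrier_mul directed_neg_part.
by rewrite mulrBr !mulrBl pgp qgn pn qp subr0 sub0r opprK.
Qed.

Lemma signum_sqrE : s * s = p + q.
Proof.
have [pq qp] := carrier_parts_orthogonal.
by rewrite mulrBr !mulrBl pp qq pq qp subr0 sub0r opprK.
Qed.

Lemma signum_commutes : s * g = g * s.
Proof. by rewrite -signum_bicommutes. Qed.

Lemma signum_abs : s * a = g.
Proof.
have [pn qp] := carrier_parts_annihilate.
rewrite -[X in s * X]pos_partD_neg_part -[RHS]pos_partB_neg_part.
have [pgp _] := carrier_mul directed_pos_part.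
have [qgn _] := carrier_mul directed_neg_part.
by rewrite mulrDr !mulrBl pgp qgn pn qp subr0 sub0r.
Qed.

(** Since [a = s * g], [g * x = 0] forces [a * x = 0]; then both parts of [g], and so both carriers,
    annihilate [x]. *)
Lemma signum_annihilates x : G x -> g * x = 0 -> s * x = 0.
Proof.
move=> Gx gx.
have [[_ pann] _] := carrierP directed_pos_part.
have [[_ qann] _] := carrierP directed_neg_part.
have ax : a * x = 0 by rewrite -signum_mul -mulrA gx mulr0.
have px : p * x = 0.
  by apply/(pann _ Gx); rewrite /pos_part -mulrA mulrDl ax gx addr0 mulr0.
have qx : q * x = 0.
  by apply/(qann _ Gx); rewrite /neg_part -mulrA mulrBl ax gx subr0 mulr0.
by rewrite mulrBl px qx subr0.
Qed.

Lemma signum_carrier : is_carrier g (s ^+ 2).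
Proof.
have [pq qp] := carrier_parts_orthogonal.
rewrite expr2 signum_sqrE; split.
  split; first exact: directedD.
  by rewrite expr2 mulrDl !mulrDr pp qq pq qp addr0 add0r.
move=> x Gx; rewrite -signum_sqrE; split => [gx|ssx].
  by rewrite -mulrA (signum_annihilates Gx gx) mulr0.
(* For the converse, [s * s] is moved to the right of [g], where it meets [x]. *)
have sg : g = s * s * g by rewrite -mulrA signum_mul signum_abs.
have gss : g = g * (s * s).
  by rewrite mulrA -signum_commutes -mulrA -signum_commutes mulrA.
by rewrite [X in X * _]gss -mulrA ssx mulr0.
Qed.

Lemma signum_is_signum : is_signum E g s.
Proof.
have Gs := directed_signum.
split => //.
- split; first by split => // y ->; exact: signum_commutes.
  by split => // y [_ [Gy yg]]; rewrite signum_bicommutes //; exact: yg.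
- split; first by rewrite /le_G subr0 signum_mul.
    exact: signum_commutes.
  by rewrite -signum_commutes signum_mul.
- by rewrite expr2 -mulrA signum_mul signum_abs.
- by move=> x; exact: signum_annihilates.
Qed.

(* Any signum [t] commutes with the projections [p] and [q], hence with [s], and
   [t * g] is again the square root of [g ^ 2]; so [g], and with it both [s] and
   [t], annihilates [s - t]. *)
Lemma signum_unique t : is_signum E g t -> s = t.
Proof.
move=> [Gt [[_ tg] [_ tCPC]] [Ptg tgC _] gE tann].
have Gs := directed_signum.
have {}tg : t * g = g * t by exact: tg.
have pg : p * g = g * p by case: (comm_carrier_parts hg erefl) => ->.
have qg : q * g = g * q by case: (comm_carrier_parts hg erefl) => _ ->.
have tp : t * p = p * t.
  apply: tCPC; split; first by split; rewrite ?expr2.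
  by split => // y ->.
have tq : t * q = q * t.
  apply: tCPC; split; first by split; rewrite ?expr2.
  by split => // y ->.
have at_ : a = t * g.
  apply: abs_G_unique; first by move: Ptg; rewrite /le_G subr0.
  by rewrite {1}tg -mulrA [t * (t * g)]mulrA -expr2 -gE.
have Gst : G (s - t) by exact: directedB.
have gst : g * (s - t) = 0.
  by rewrite mulrBr -signum_commutes -tg signum_mul -at_ subrr.
apply: subr0_eq; apply: sqr_eq0_directed => //.
by rewrite mulrBl signum_annihilates // tann // subrr.
Qed.

End Signum.
End ERing.

Theorem theorem5p5 (R : nzRingType) (E : set R)
    (hE : e_ring E) (hAH : AH_algebra E) (g : R) (hg : directed_group E g) :
  let s := carrier E (pos_part E g) - carrier E (neg_part E g) in
  [/\ unique (is_signum E g) s,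
      polar_decomposition_property E
    & [/\ bicommutant E [set g] s,
          carrier E g = s ^+ 2,
          abs_G E g = s * g /\ s * g = g * s,
          g = s * abs_G E g /\ s * abs_G E g = abs_G E g * s
        & carrier E (abs_G E g) = carrier E g]].
Proof.
move=> s.
have sg : s * g = abs_G E g := signum_mul hE hAH hg.
have sa : s * abs_G E g = g := signum_abs hE hAH hg.
have sgC : s * g = g * s := signum_commutes hE hAH hg.
have gE := carrier_unique hE hAH (signum_carrier hE hAH hg).
split.
- by split; [exact: signum_is_signum|move=> t; exact: signum_unique].
- by move=> x Gx; eexists; exact: (signum_is_signum hE hAH Gx).
split => //.
- split; first exact: directed_signum.
  by move=> y [Gy yg]; rewrite -signum_bicommutes //; exact: yg.
- split => //; have [Pa _ aC] := abs_GP hE hAH hg.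
  have Ga := directed_Eplus Pa.
  by rewrite -signum_bicommutes // -aC.
(* The elements [g] and [abs_G E g] have the same annihilator, each being [s] times the other. *)
- rewrite gE; apply: carrier_unique => //.
  have [proj ann] := signum_carrier hE hAH hg; split => // x Gx.
  apply: iff_trans (ann x Gx); split => [ax|gx].
    by rewrite -sa -mulrA ax mulr0.
  by rewrite -sg -mulrA gx mulr0.
Qed.
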